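(* For all positive integers $d,n$, the abacus blob monoid satisfies $$|\mathfrak{Bl}_{d,n}|=d^{n}\sum_{k=0}^{n}\Omega_k^{(n)}d^k.$$
   Context: Blobbed TL-diagrams: place top points $1,\dots,n$ and bottom points $1',\dots,n'$ on the two boundary lines of the strip $\mathbb{R}\times[0,1]$; a TL-diagram is a non-crossing perfect matching of these $2n$ points drawn as $n$ disjoint arcs in the strip, up to isotopy. The left side is the unbounded complementary region containing points $(x,1/2)$ with $x$ very negative; an arc is exposed to the left if it lies on its boundary. A blobbed TL-diagram is a TL-diagram in which some left-exposed arcs carry one blob each. Abacus blob monoid $\mathfrak{Bl}_{d,n}$: an element is a blobbed TL-diagram together with a label in $\mathbb{Z}/d\mathbb{Z}$ (number of beads mod $d$) on each component, where an unblobbed arc is one component and a blobbed arc is split by its blob into two components, each containing one endpoint. Two such are equal iff the underlying blobbed TL-diagrams and all labels agree. Product $X\cdot Y$: place $X$ above $Y$, identify the bottom points of $X$ with the top points of $Y$; delete closed loops with all their decorations; each resulting arc joining two outer points is a chain of pieces; if no piece has a blob, the resulting arc is unblobbed with label the sum of all labels along it; otherwise the resulting arc carries exactly one blob and each of its two components gets the sum of labels met when travelling from the corresponding endpoint up to the first blob (labels between two blobs are discarded). Indexing matrices (for $n$): either the degenerate matrix $\left[\begin{smallmatrix}\infty\\ \infty\end{smallmatrix}\right]$, or a $2\times m$ matrix $A=[a_{ij}]$ with $1\le m\le n$ such that: $a_{ij}\in[0,n-1]$; $a_{1j}<a_{1k}$ for $j<k$; $a_{2j}\le a_{2k}$ for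 $j<k$; if $a_{2j}=a_{2k}$ with $j<k$ then $a_{2j}=a_{2k}=0$; $a_{1j}\ge a_{2j}$ for all $j$. The blob-rank of $A$ is the number of its columns containing a $0$ (the degenerate matrix has blob-rank $0$). $\Omega_r^{(n)}$ denotes the number of indexing matrices for $n$ of blob-rank $r$. *)

(* Defs.v *)
From mathcomp Require Import all_boot all_order all_algebra.

Set Implicit Arguments.
Unset Strict Implicit.
Unset Printing Implicit Defensive.

Section Diagrams.

Variable n : nat.

(* [inl i] is the top point i+1 and [inr i] the bottom point (i+1)'. *)
Definition point : finType := ('I_n + 'I_n)%type.

(* Position on the boundary of the strip, read clockwise from the left side:
   1, ..., n, n', ..., 1' get the positions 0, ..., 2n-1. *)
Definition pos (x : point) : nat :=
  match x with inl i => i | inr i => n + rev_ord i end.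

(* An arc, up to isotopy, is the set of its two endpoints. *)
Definition arc : finType := {set point}.

Definition crossing (a b : arc) : bool :=
  [exists x in a, exists y in a, exists z in b, exists t in b,
    [&& pos x < pos z, pos z < pos y & pos y < pos t]].

Definition is_TL (M : {set arc}) : bool :=
  [&& partition M [set: point],
      [forall a in M, #|a| == 2] &
      [forall a in M, forall b in M, ~~ crossing a b]].

(* The 2n points cut the boundary into gaps: gap g lies between the positions
   g-1 and g, and the gaps 0 and 2n meet at the left end of the strip. Two gaps
   bound the same complementary region iff no arc separates them. *)
Definition separates_from_left (a : arc) (g : nat) : bool :=
  [exists x in a, exists y in a, pos x < g <= pos y].

Definition left_gap (M : {set arc}) (g : nat) : bool :=
  [forall a in M, ~~ separates_from_left a g].

(* The two sides of an arc are met in the gaps next to its endpoints. *)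
Definition exposed (M : {set arc}) (a : arc) : bool :=
  [exists x in a, left_gap M (pos x) || left_gap M (pos x).+1].

(* A pair (M, B): the diagram M and the set B of its blobbed arcs. *)
Definition is_blobbed_TL (D : {set arc} * {set arc}) : bool :=
  is_TL D.1 && (D.2 \subset [set a in D.1 | exposed D.1 a]).

Definition blobbed_TL : finType :=
  {D : {set arc} * {set arc} | is_blobbed_TL D}.

(* A component is recorded by the set of endpoints it contains: both for an
   unblobbed arc, a single one for either part of a blobbed arc. *)
Definition components (D : blobbed_TL) : {set {set point}} :=
  let: (M, B) := val D in (M :\: B) :|: [set [set x] | x in cover B].

Definition component (D : blobbed_TL) : finType :=
  {c : {set point} | c \in components D}.

End Diagrams.

(* Underlying set of the abacus blob monoid. Z/dZ is represented by its residues
   'I_d ('Z_d would be Z/2Z for d = 1). *)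
Definition abacus_blob (d n : nat) : finType :=
  {D : blobbed_TL n & {ffun component D -> 'I_d}}.

(* [None] is the degenerate matrix with both entries infinite. *)
Definition raw_matrix (n : nat) : finType :=
  option {m : 'I_n.+1 & 'M['I_n]_(2, m)}.

Definition is_indexing (n : nat) (A : raw_matrix n) : bool :=
  match A with
  | None => true
  | Some (existT m a) =>
    let a1 (j : 'I_m) : nat := a ord0 j in
    let a2 (j : 'I_m) : nat := a ord_max j in
    [&& 0 < m,
        [forall j : 'I_m, forall k : 'I_m, (j < k) ==> (a1 j < a1 k)],
        [forall j : 'I_m, forall k : 'I_m, (j < k) ==> (a2 j <= a2 k)],
        [forall j : 'I_m, forall k : 'I_m, (j < k) && (a2 j == a2 k) ==> (a2 j == 0)] &
        [forall j : 'I_m, a2 j <= a1 j]]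
  end.

Definition blob_rank (n : nat) (A : raw_matrix n) : nat :=
  match A with
  | None => 0
  | Some (existT m a) => #|[set j : 'I_m | [exists i, a i j == 0 :> nat]]|
  end.

Definition Omega (n r : nat) : nat :=
  #|[set A : raw_matrix n | is_indexing A && (blob_rank A == r)]|.

(* Main.v *)
Require Import Defs.
From mathcomp Require Import all_boot all_order all_algebra.
From mathcomp Require Import zify.

(** A blobbed diagram with [b] blobs has [n + b] components, so the cardinality
is [d ^ n] times the sum over TL-diagrams of [(d + 1) ^ e], [e] being the number
of exposed arcs. Reading the boundary points in order, a TL-diagram becomes a walk
on the naturals (the number of open arcs) from 0 to 0 of length [2n], and the
exposed arcs are the returns to 0: each step from 1 to 0 has weight [d + 1].

On the other side, processing the entries of the first row of an indexing matrix
in decreasing order gives a recurrence whose solution counts the unweighted walks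
of length [2n] from 0, a walk ending at [2k] having weight [d ^ k]. Both families
of walk counts, taken as functions of the starting height, differ by the factor
[1 / (1 - d T^2)], with [T] the shift by one, and agree at height 0. *)

(** * Weighted walks on the naturals *)

(** [m] is the number of steps left and [h] the current height. *)
Fixpoint blob_walks (d m h : nat) : nat :=
  if m is m'.+1 then
    blob_walks d m' h.+1 +
    (if h is h'.+1 then d.+1 ^ (h' == 0) * blob_walks d m' h' else 0)
  else h == 0.

Fixpoint free_walks (d m h : nat) : nat :=
  if m is m'.+1 then
    free_walks d m' h.+1 + (if h is h'.+1 then free_walks d m' h' else 0)
  else ~~ odd h * d ^ h./2.

(** The two step rules differ only at height 1, where the down step of [blob_walks] has weight
    [d + 1]: the part 1 is the down step of [free_walks], and the part [d] is the correction term of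
    its up step to height 2. *)
Lemma free_walksE d m h :
  free_walks d m h =
    blob_walks d m h + (if h is h'.+2 then d * free_walks d m h' else 0).
Proof.
elim: m h => [|m IHm] [|[|h]] //=; rewrite ?negbK ?addn0 ?mul0n //.
- by rewrite add0n mulnCA expnS.
- by rewrite IHm addn0.
- by rewrite !IHm /= !addn0; lia.
- rewrite (IHm h.+3) (IHm h.+1); case: h => [|h] /=; first by lia.
  by rewrite expn0; lia.
Qed.

(** With [m <= h] the boundary 0 never blocks a step, so raising a walk by 2 is a bijection, which
    multiplies the weight of the end by [d]. *)
Lemma free_walks_high d m h :
  m <= h -> free_walks d m h.+2 = d * free_walks d m h.
Proof.
elim: m h => [|m IHm] [|h] //= lemh; rewrite ?negbK.
- by rewrite mulnCA -expnS.
- by rewrite mulnCA -expnS.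
- by rewrite !IHm ?mulnDr //; lia.
Qed.

Lemma free_walks_diag d m : free_walks d m m = d.+1 ^ m.
Proof. by elim: m => //= m IHm; rewrite free_walks_high // IHm expnS; lia. Qed.

(** * Lists of columns and their weighted count *)

(** The conditions on both rows for a column [u] left of a column [v]; a pair holds the first-row
    entry, then the second-row entry. *)
Definition col_lt (u v : nat * nat) : bool :=
  (u.1 < v.1) && ((u.2 < v.2) || (u.2 == 0) && (v.2 == 0)).

Definition col_in (a b : nat) (u : nat * nat) : bool :=
  (u.2 <= u.1 < a) && (u.2 < b).

(* A column [(a, c)] with [c = 0] may only follow columns with second entry 0: this
   is what the bound [maxn c 1] expresses. *)
Fixpoint index_lists (a b : nat) : seq (seq (nat * nat)) :=
  if a is a'.+1 then
    index_lists a' b ++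
    [seq rcons s (a', c) | c <- iota 0 (minn b a), s <- index_lists a' (maxn c 1)]
  else [:: [::]].

Lemma mem_index_lists a b s :
  (s \in index_lists a b) = pairwise col_lt s && all (col_in a b) s.
Proof.
elim: a b s => [|a IHa] b s /=.
  by case: s => [|[x y] s] //=; rewrite inE /col_in /= ltn0 andbF andbF.
rewrite mem_cat IHa; case: (lastP s) => [|{}s [x c]] //.
rewrite !pairwise_rcons !all_rcons.
have -> : (rcons s (x, c) \in [seq rcons t (a, c0) | c0 <- iota 0 (minn b a.+1),
   t <- index_lists a (maxn c0 1)]) =
   [&& x == a, c < b, c <= a & s \in index_lists a (maxn c 1)].
  apply/allpairsPdep/idP => [[c0 [t []]]|].
    rewrite mem_iota => c0P tP /rcons_inj[-> -> ->]; rewrite eqxx tP; lia.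
  case/and4P=> /eqP -> h1 h2 h3; exists c, s; split => //.
  by rewrite mem_iota; lia.
rewrite IHa /col_in /=.
have allE (P Q : pred (nat * nat)) : all P s && all Q s = all (predI P Q) s.
  by rewrite all_predI.
case: (pairwise _ s); rewrite ?andbF // !andbT !andTb.
have bound u : u \in s -> all (col_lt^~ (x, c)) s -> u.1 < x.
  by move=> us /allP/(_ u us)/andP[].
(* If [x < a], all earlier first entries are below [x], so the bounds [a] and [a.+1] agree; the
   appended branch matters only for [x = a]. *)
case: (ltngtP x a) => [ltxa|ltax|->]; rewrite ?orbF ?andFb ?andTb ?andbF ?orFb.
- case allx: (all _ s) bound => //= bound; congr (_ && _); first by lia.
  apply: eq_in_all => u us; have /= := bound u us isT; lia.
- have -> : x < a.+1 = false by lia.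
  by rewrite !andbF.
rewrite ltnSn andbT andbC [in RHS]andbCA [in RHS]andbC !andbA.
case ltcb: (c < b); case leca: (c <= a); rewrite ?andbT ?andbF // allE.
apply: eq_in_all => u _ /=; rewrite /col_lt /=; lia.
Qed.

Definition index_sum (d a b : nat) : nat :=
  \sum_(s <- index_lists a b) d ^ count (fun u => u.2 == 0) s.

Lemma index_sum0 d b : index_sum d 0 b = 1.
Proof. by rewrite /index_sum big_seq1. Qed.

(** Either no first entry equals [a], or the last column is [(a, c)], of weight [d] if [c = 0] and 1
    otherwise. *)
Lemma index_sumS d a b : index_sum d a.+1 b =
  index_sum d a b +
  \sum_(0 <= c < minn b a.+1) d ^ (c == 0) * index_sum d a (maxn c 1).
Proof.
rewrite /index_sum /= big_cat /=; congr (_ + _).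
rewrite big_allpairs_dep /index_iota subn0; apply: eq_bigr => c _.
rewrite big_distrr /=; apply: eq_bigr => s _.
by rewrite -expnD -cats1 count_cat /= addn0 addnC.
Qed.

Lemma index_sumS1 d a : index_sum d a.+1 1 = d.+1 * index_sum d a 1.
Proof.
by rewrite index_sumS (_ : minn 1 a.+1 = 1) ?big_nat1 /=; [rewrite expn1 mulSn | lia].
Qed.

(** In the expansions of [index_sumS] for the bounds [b.+1] and [b], the sums over [c] differ by the
    term [c = b], which equals the leading term [index_sum d a b] of the second. *)
Lemma index_sumSS d a b : 0 < b -> b <= a ->
  index_sum d a.+1 b.+1 = index_sum d a.+1 b + index_sum d a b.+1.
Proof.
move=> b_gt0 leba; rewrite !index_sumS.
have -> : minn b.+1 a.+1 = b.+1 by lia.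
have -> : minn b a.+1 = b by lia.
rewrite big_nat_recr //= gtn_eqF // mul1n (maxn_idPl b_gt0).
by rewrite addnC [X in X + _]addnC.
Qed.

(** Second entries do not exceed first entries, which are below [a], so a larger bound [b] excludes
    nothing. *)
Lemma index_sum_stable d a b : a < b -> index_sum d a b = index_sum d a a.+1.
Proof.
elim: a b => [|a IHa] b ltab; first by rewrite !index_sum0.
rewrite !index_sumS (IHa b) ?(IHa a.+2) //; last by lia.
have -> : minn b a.+1 = a.+1 by lia.
have -> : minn a.+2 a.+1 = a.+1 by lia.
by [].
Qed.

(** [index_sumSS] is the step rule at height [a - b] with [a + b] steps left: lowering [b] is an up
    step, lowering [a] a down step. *)
Lemma index_sum_walks d a b : b <= a ->
  index_sum d a b.+1 = free_walks d (a + b) (a - b).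
Proof.
elim: a b => [|a IHa] b; first by case: b => // _; rewrite index_sum0.
elim: b => [|b IHb] leba.
  (* On the edge [b = 0] both sides are [d.+1 ^ a.+1]. *)
  by rewrite index_sumS1 IHa // !addn0 !subn0 !free_walks_diag expnS.
rewrite addnS subSS [free_walks _ _ _]/=.
have [ltba|leab] := ltnP b a.
  rewrite index_sumSS // IHb ?IHa //; last by lia.
  rewrite (_ : a - b = (a - b.+1).+1); last by lia.
  have -> : a.+1 - b = (a - b.+1).+2 by lia.
  by rewrite addnS.
(* At height 0 only the up step exists; correspondingly, raising the bound from [a.+1] to [a.+2]
   adds no list. *)
have eqab : b = a by lia.
move: IHb; rewrite eqab subnn subSnn /= addn0 => /(_ (leqnSn a)) <-.
rewrite !index_sumS (index_sum_stable _ _ a.+2) //.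
have -> : minn a.+2 a.+1 = a.+1 by lia.
by rewrite minnn.
Qed.

(** The first step from height 0 goes up, so the walk from height 1 given by [index_sum_walks]
    extends to one of length [n + n] from 0, where [free_walksE] has no correction term. *)
Lemma index_sum_blob_walks d n : 0 < n ->
  index_sum d n n = blob_walks d (n + n) 0.
Proof.
case: n => // n _; rewrite index_sum_walks // subSnn addSn addnS.
by have := free_walksE d (n + n).+2 0; rewrite addn0 => <- /=; rewrite addn0.
Qed.

(** * Indexing matrices as lists of columns *)

Definition columns {n} (A : raw_matrix n) : seq (nat * nat) :=
  match A with
  | None => [::]
  | Some (existT m a) =>
    [seq (nat_of_ord (a ord0 j), nat_of_ord (a ord_max j)) | j <- enum 'I_m]
  end.

Lemma pairwise_enum_ord m (r : rel 'I_m) :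
  pairwise r (enum 'I_m) = [forall j : 'I_m, forall k : 'I_m, (j < k) ==> r j k].
Proof.
case: m r => [|m] r.
  rewrite (size0nil (size_enum_ord 0)) /=; apply/esym/forallP; by case.
apply/(pairwiseP ord0)/idP => [rP | /forallP rP j k].
  apply/forallP => j; apply/forallP => k; apply/implyP => ltjk.
  by have := rP j k; rewrite !inE size_enum_ord !ltn_ord !nth_ord_enum; apply.
rewrite !inE size_enum_ord => ltj ltk ltjk.
have /forallP/(_ (Ordinal ltk))/implyP := rP (Ordinal ltj).
have -> : nth ord0 (enum 'I_m.+1) j = Ordinal ltj.
  exact: (nth_ord_enum ord0 (Ordinal ltj)).
have -> : nth ord0 (enum 'I_m.+1) k = Ordinal ltk.
  exact: (nth_ord_enum ord0 (Ordinal ltk)).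
exact.
Qed.

Lemma is_indexing_columns n (m : 'I_n.+1) (a : 'M['I_n]_(2, m)) :
  let A := Some (existT (fun m : 'I_n.+1 => 'M['I_n]_(2, m)) m a) in
  is_indexing A =
  [&& 0 < m, pairwise col_lt (columns A) & all (col_in n n) (columns A)].
Proof.
rewrite /= pairwise_map pairwise_enum_ord all_map.
set col := fun j : 'I_m => (_, _).
have -> : all (preim col (col_in n n)) (enum 'I_m) =
    [forall j : 'I_m, a ord_max j <= a ord0 j].
  apply/allP/forallP => [allA j | allA j _]; last by rewrite /= /col_in /= allA !ltn_ord.
  by have /andP[/andP[]] := allA j (mem_enum _ _).
congr (_ && _); rewrite !andbA; congr (_ && _).
apply/idP/forallP => [/andP[/andP[/forallP h1 /forallP h2] /forallP h3] j|h].
  apply/forallP => k; apply/implyP => ltjk.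
  move: (h1 j) (h2 j) (h3 j) => /forallP/(_ k) + /forallP/(_ k) + /forallP/(_ k).
  by rewrite ltjk /col_lt /=; lia.
do 2?[apply/andP; split]; apply/forallP => j; apply/forallP => k;
  apply/implyP; last case/andP; move=> ltjk;
  have /forallP/(_ k) := h j; rewrite ltjk /col_lt /=; lia.
Qed.

(** A zero in the first row forces a zero below it, so only second entries need testing. *)
Lemma blob_rank_columns n (A : raw_matrix n) :
  is_indexing A -> blob_rank A = count (fun u => u.2 == 0) (columns A).
Proof.
case: A => [[m a]|] //; rewrite is_indexing_columns /= => /and3P[_ _ /allP colA].
rewrite count_map -sum1_count big_enum_cond -sum1_card; apply: eq_bigl => j.
rewrite inE andTb /=; apply/existsP/idP => [[i]|a2j0]; last by exists ord_max.
have /colA/andP[/andP[/= le21 _] _] :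
    (nat_of_ord (a ord0 j), nat_of_ord (a ord_max j)) \in columns
      (Some (existT (fun m : 'I_n.+1 => 'M['I_n]_(2, m)) m a)).
  by apply/mapP; exists j; rewrite ?mem_enum.
have [->|->] // : i = ord0 \/ i = ord_max.
  by case: i => [] [|[|]] // ?; [left | right]; apply: val_inj.
by move/eqP => a1j0; move: le21; rewrite a1j0 leqn0.
Qed.

Lemma columns_inj n : {in @is_indexing n &, injective (@columns n)}.
Proof.
have size_columns (m : 'I_n.+1) a :
    size (columns (Some (existT (fun m : 'I_n.+1 => 'M['I_n]_(2, m)) m a))) = m.
  by rewrite size_map size_enum_ord.
case=> [[m a]|] [[m' a']|] //; rewrite !unfold_in => idxA idxA' eqcol.
- have eqm : m = m' by apply: val_inj; rewrite /= -(size_columns m a) eqcol size_columns.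
  subst m'; congr (Some (existT _ m _)); apply/matrixP => i j.
  have [] := proj2 (eq_in_map _ _ _) eqcol j (mem_enum _ j).
  case: i => [] [|[|]] // lti eq1 eq2; apply: val_inj.
    by rewrite (_ : Ordinal lti = ord0) //; apply: val_inj.
  by rewrite (_ : Ordinal lti = ord_max) //; apply: val_inj.
- have /andP[m_gt0 _] := idxA.
  by exfalso; move: m_gt0; rewrite -(size_columns m a) eqcol.
- have /andP[m_gt0 _] := idxA'.
  by exfalso; move: m_gt0; rewrite -(size_columns m' a') -eqcol.
Qed.

Lemma size_index_list n s : pairwise col_lt s -> all (col_in n n) s -> size s <= n.
Proof.
move=> lt_s /allP in_s.
have sorted_s : sorted ltn (map fst s).
  rewrite sorted_pairwise ?pairwise_map; last exact: ltn_trans.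
  by apply: sub_pairwise lt_s => u v /andP[].
have uniq_s := sorted_uniq ltn_trans ltnn sorted_s.
rewrite -(size_map fst) -(size_iota 0 n); apply: uniq_leq_size uniq_s _ => x.
by case/mapP=> u /in_s /andP[/andP[_ ltun] _] ->; rewrite mem_iota.
Qed.

Lemma columns_onto n s : pairwise col_lt s -> all (col_in n n) s ->
  exists2 A : raw_matrix n, is_indexing A & columns A = s.
Proof.
(* The empty list comes from the degenerate matrix. *)
move=> lt_s in_s; have [->|s_neq0] := eqVneq s [::]; first by exists None.
have les := size_index_list _ _ lt_s in_s.
(* [inord] needs a nonempty ordinal type; for [n = 0] the size bound makes [s] empty. *)
case: n in_s les => [|n] in_s les; first by case: s s_neq0 les {lt_s in_s}.
pose m := Ordinal (les : size s < n.+2).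
pose entry (i : 'I_2) (j : 'I_m) : 'I_n.+1 :=
  inord (if i == ord0 then (nth (0, 0) s j).1 else (nth (0, 0) s j).2).
pose a : 'M['I_n.+1]_(2, m) := (\matrix_(i, j) entry i j)%R.
have col_a : columns (Some (existT (fun m : 'I_n.+2 => 'M['I_n.+1]_(2, m)) m a)) = s.
  rewrite -[RHS](mkseq_nth (0, 0)) /mkseq -val_enum_ord -map_comp.
  apply: eq_map => j /=; rewrite !mxE /entry /=.
  have /andP[/andP[]] := allP in_s _ (mem_nth (0, 0) (ltn_ord j)).
  by case: (nth _ _ _) => x y /= leyx ltxn ltyn; rewrite !inordK.
exists (Some (existT (fun m : 'I_n.+2 => 'M['I_n.+1]_(2, m)) m a)) => //.
by rewrite is_indexing_columns col_a lt_s in_s lt0n size_eq0 s_neq0.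
Qed.

Lemma index_lists_uniq a b : uniq (index_lists a b).
Proof.
elim: a b => //= a IHa b; rewrite cat_uniq IHa /=; apply/andP; split.
  apply/hasPn => t /allpairsPdep[c [s [_ _ ->]]].
  rewrite /= mem_index_lists all_rcons /col_in /= ltnn !andbF //.
apply: allpairs_uniq_dep => [|c _|[c s] [c' s'] _ _ /=]; rewrite ?iota_uniq //.
by case/rcons_inj => -> ->.
Qed.

Lemma is_indexing_index_list n (A : raw_matrix n) :
  is_indexing A -> columns A \in index_lists n n.
Proof.
rewrite mem_index_lists; case: A => [[m a]|] //.
by rewrite is_indexing_columns => /and3P[_ -> ->].
Qed.

Lemma sum_Omega d n :
  \sum_(0 <= k < n.+1) Omega n k * d ^ k = index_sum d n n.
Proof.
(* Matrices are grouped by blob-rank, at most [n] since there are at most [n] columns. *)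
transitivity (\sum_(A : raw_matrix n | is_indexing A) d ^ blob_rank A).
  have rank_le (A : raw_matrix n) : blob_rank A < n.+1.
    case: A => [[m a]|] //=; apply: leq_ltn_trans (max_card _) _.
    by rewrite card_ord.
  rewrite big_mkord (partition_big (fun A => Ordinal (rank_le A)) xpredT) //=.
  apply: eq_bigr => k _; rewrite -sum_nat_const.
  by apply: eq_big => [A|A]; rewrite inE // => /andP[_ /eqP ->].
under eq_bigr => A idxA do rewrite blob_rank_columns //.
rewrite -big_enum /index_sum /=.
rewrite -(big_map (@columns n) xpredT (fun s => d ^ count (fun u => u.2 == 0) s)).
apply/perm_big/uniq_perm; last move=> s.
- rewrite map_inj_in_uniq ?enum_uniq // => A B; rewrite !mem_enum.
  exact: columns_inj.
- exact: index_lists_uniq.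
apply/mapP/idP => [[A]|].
  by rewrite mem_enum => idxA ->; apply: is_indexing_index_list.
rewrite mem_index_lists => /andP[lt_s in_s].
have [A idxA <-] := columns_onto _ _ lt_s in_s.
by exists A; rewrite ?mem_enum.
Qed.

(** * Boundary positions and arcs of TL-diagrams *)

Lemma pos_inj n : injective (@pos n).
Proof.
have ltn_n (i : 'I_n) := ltn_ord i.
case=> [] i [] j /= eqij; try by have := ltn_n i; have := ltn_n j; lia.
  by congr inl; apply: val_inj.
by congr inr; apply: rev_ord_inj; apply/val_inj/(addnI eqij).
Qed.

Lemma pos_lt n (x : point n) : pos x < n + n.
Proof. by case: x => i /=; have := ltn_ord i; lia. Qed.

Lemma pos_surj n p : p < n + n -> exists x : point n, pos x = p.
Proof.
move=> ltp; case: (ltnP p n) => [ltpn|lenp]; first by exists (inl (Ordinal ltpn)).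
have ltq : p - n < n by lia.
by exists (inr (rev_ord (Ordinal ltq))) => /=; lia.
Qed.

Section Matchings.

Variable n : nat.
Implicit Types (x y z s t : point n) (a b : Defs.arc n) (M : {set Defs.arc n}).

Lemma TL_partition {M} : is_TL M -> partition M [set: point n].
Proof. by case/and3P. Qed.

Lemma TL_card {M a} : is_TL M -> a \in M -> #|a| = 2.
Proof. by case/and3P=> _ /forall_inP cardM _ /cardM /eqP. Qed.

Lemma TL_eq {M a b x} :
  is_TL M -> a \in M -> b \in M -> x \in a -> x \in b -> a = b.
Proof.
case/TL_partition/and3P=> _ /trivIsetP tiM _ aM bM xa xb.
apply/eqP; apply: contraTT isT => /(tiM _ _ aM bM) /disjointFr /(_ xa).
by rewrite xb.
Qed.

Lemma TL_noncrossing {M a b x y z t} :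
  is_TL M -> a \in M -> b \in M -> x \in a -> y \in a -> z \in b -> t \in b ->
  pos x < pos z -> pos z < pos y -> pos y < pos t -> False.
Proof.
case/and3P=> _ _ /forall_inP ncM aM bM xa ya zb tb ltxz ltzy ltyt.
have /forall_inP/(_ b bM)/negP := ncM a aM; apply.
apply/exists_inP; exists x => //; apply/exists_inP; exists y => //.
apply/exists_inP; exists z => //; apply/exists_inP; exists t => //.
by rewrite ltxz ltzy ltyt.
Qed.

Lemma TL_arc {M} x : is_TL M -> exists y, y != x /\ [set x; y] \in M.
Proof.
move=> TLM; have /and3P[/eqP covM tiM _] := TL_partition TLM.
have xM : x \in cover M by rewrite covM inE.
have aM := pblock_mem xM; have xa : x \in pblock M x by rewrite mem_pblock.
have /cards2P[u [v [neuv def_a]]] : #|pblock M x| == 2 by rewrite (TL_card TLM aM).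
rewrite def_a in aM xa; move: xa aM; rewrite !inE => /orP[]/eqP -> aM.
  by exists v; rewrite eq_sym.
by exists u; rewrite setUC.
Qed.

(** * Reading a diagram position by position *)

(** The arcs already finished when position [p] is reached. *)
Definition restr (p : nat) M : {set Defs.arc n} :=
  [set a in M | [forall x in a, pos x < p]].

(** For [restr p M], these are the left ends of the arcs still open at gap [p]; their number is the
    height of the walk. *)
Definition open_pts (p : nat) M : {set point n} :=
  [set x | (pos x < p) && (x \notin cover M)].

Lemma restrP p M a :
  reflect (a \in M /\ forall x, x \in a -> pos x < p) (a \in restr p M).
Proof. by rewrite inE; apply: (iffP andP) => -[aM /forall_inP ap]. Qed.

Lemma in_cover_arc M a x : a \in M -> x \in a -> x \in cover M.
Proof. by move=> aM xa; apply/bigcupP; exists a. Qed.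

Lemma openP p M x : is_TL M ->
  reflect (pos x < p /\ exists y, [set x; y] \in M /\ p <= pos y)
          (x \in open_pts p (restr p M)).
Proof.
move=> TLM; rewrite inE; apply: (iffP andP) => [] [ltxp].
  move=> xNcov; split=> //; have [y [neyx aM]] := TL_arc x TLM.
  exists y; split=> //; rewrite leqNgt; apply: contra xNcov => ltyp.
  apply: (@in_cover_arc _ [set x; y]); rewrite ?set21 //.
  by apply/restrP; split=> // z /set2P[] ->.
case=> y [aM lepy]; split=> //; apply/bigcupP => -[b /restrP[bM bp] xb].
have eqab := TL_eq TLM aM bM (set21 x y) xb.
by have := bp y; rewrite -eqab set22 => /(_ isT); lia.
Qed.

(** An arc separates gap [p] from the left end iff it is open there, so left gaps are the visits of
    the walk to 0. *)
Lemma left_gapE p M : is_TL M ->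
  left_gap M p = (open_pts p (restr p M) == set0).
Proof.
move=> TLM; apply/forall_inP/eqP => [gapM|open0 a aM].
  apply/setP => x; rewrite in_set0; apply/(openP _ _ _ TLM) => -[ltxp [y [aM lepy]]].
  have /negP := gapM _ aM; apply; apply/exists_inP; exists x; first exact: set21.
  by apply/exists_inP; exists y; rewrite ?set22 ?ltxp.
apply/exists_inP => -[x xa /exists_inP[y ya /andP[ltxp lepy]]].
have : x \in open_pts p (restr p M); last by rewrite open0 inE.
rewrite inE ltxp; apply/bigcupP => -[b /restrP[bM bp] xb].
by have := bp y; rewrite -(TL_eq TLM aM bM xa xb) ya => /(_ isT); lia.
Qed.

Lemma restr_restr p M : restr p (restr p.+1 M) = restr p M.
Proof.
apply/setP => a; apply/restrP/restrP => [[/restrP[]]|[aM ap]] //.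
by split=> //; apply/restrP; split=> // x /ap; lia.
Qed.

Lemma restr_all M : restr (n + n) M = M.
Proof.
by apply/setP => a; apply/restrP/idP => [[]//|aM]; split=> // x _; apply: pos_lt.
Qed.

(** Invariants of the finished part of a diagram, stated without the diagram. [partial_open] forbids
    an open point under a finished arc, where it could not be matched later without a crossing. *)
Record partial_TL (p : nat) M : Prop := PartialTL {
  partial_trivIset : trivIset M;
  partial_card : forall a, a \in M -> #|a| = 2;
  partial_lt : forall a x, a \in M -> x \in a -> pos x < p;
  partial_noncrossing : forall a b, a \in M -> b \in M -> ~~ crossing a b;
  partial_open : forall a x y s, a \in M -> x \in a -> y \in a ->
    s \in open_pts p M -> ~~ (pos x < pos s < pos y) }.

Definition is_top (p : nat) M s : Prop :=
  s \in open_pts p M /\ (forall t, t \in open_pts p M -> pos t <= pos s).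

Lemma exists_top p M : open_pts p M != set0 -> exists s, is_top p M s.
Proof.
case/set0Pn=> s0 s0P.
case: (@arg_maxnP _ s0 (mem (open_pts p M)) (@pos n) s0P) => s sP maxs.
by exists s; split.
Qed.

Lemma partial_restr p M : partial_TL p M -> restr p M = M.
Proof.
move=> partM; apply/setP => a; apply/restrP/idP => [[]//|aM]; split=> // x.
exact: (partial_lt _ _ partM).
Qed.

(* Reading the point [z] in position [p], the arc through [z] either goes on to the right
   or ends at the rightmost open point: the others are screened by it. *)
Lemma restrS p M z s : is_TL M -> pos z = p -> is_top p (restr p M) s ->
  restr p.+1 M = restr p M \/ restr p.+1 M = [set s; z] |: restr p M.
Proof.
move=> TLM posz [sopen maxs]; have [y [neyz aM]] := TL_arc z TLM.
have neyzp : pos y <> p by rewrite -posz => /pos_inj/eqP; apply/negP.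
have otherP b : b \in M -> z \notin b -> (b \in restr p.+1 M) = (b \in restr p M).
  move=> bM zNb; apply/restrP/restrP => -[_ bp]; split=> // x xb;
    last by have := bp x xb; lia.
  have := bp x xb; rewrite ltnS leq_eqVlt => /orP[/eqP eqxp|//].
  by rewrite -posz in eqxp; rewrite -(pos_inj _ _ _ eqxp) xb in zNb.
have subP b q : b \in restr q M -> b \in M by case/restrP.
case: (ltnP p (pos y)) => [ltpy|leyp]; [left|right].
  apply/setP => b; case bM: (b \in M); last first.
    by apply/idP/idP => /subP; rewrite bM.
  have [zb|] := boolP (z \in b); last exact: otherP.
  have eqab := TL_eq TLM aM bM (set21 z y) zb.
  by apply/restrP/restrP => -[_ /(_ y)]; rewrite -eqab set22 => /(_ isT); lia.
have ltyp : pos y < p by lia.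
have yopen : y \in open_pts p (restr p M).
  by apply/(openP _ _ _ TLM); split=> //; exists z; rewrite setUC posz.
have eqys : y = s.
  apply/eqP; apply: contraTT isT => neys.
  have ltys : pos y < pos s.
    have := maxs y yopen; rewrite leq_eqVlt => /orP[/eqP/pos_inj/eqP|//].
    by rewrite (negPf neys).
  (* The partner [t] of [s] lies beyond [z], so the order [y], [s], [z], [t] yields a crossing. *)
  have [ltsp [t [bM lept]]] := openP _ _ _ TLM sopen.
  have nezt : t != z.
    apply: contra_neq neys => eqtz; rewrite eqtz in bM.
    have eqab := TL_eq TLM aM bM (set21 z y) (set22 s z).
    have : y \in [set s; z] by rewrite -eqab set22.
    by case/set2P => // eqyz; rewrite eqyz eqxx in neyz.
  have neptz : pos t <> p by rewrite -posz => /pos_inj/eqP; apply/negP.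
  case: (TL_noncrossing TLM aM bM (set22 z y) (set21 z y) (set21 s t) (set22 s t)); lia.
rewrite -eqys; apply/setP => b; rewrite in_setU1 [[set y; z]]setUC.
have [zb|zNb] := boolP (z \in b).
  case bM: (b \in M); last first.
    have [eqb|_] := eqVneq b; first by rewrite -eqb bM in aM.
    by apply/idP/idP => /subP; rewrite bM.
  rewrite -(TL_eq TLM aM bM (set21 z y) zb) eqxx /=; apply/restrP; split=> // x.
  by case/set2P => ->; lia.
have [eqb|_] /= := eqVneq b; first by rewrite eqb set21 in zNb.
case bM: (b \in M); first exact: otherP.
by apply/idP/idP => /subP; rewrite bM.
Qed.

(** An arc ending at [z] would start at a point open at [p]; as there is none, [z] begins an arc. *)
Lemma restrS0 p M z : is_TL M -> pos z = p -> open_pts p (restr p M) = set0 ->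
  restr p.+1 M = restr p M.
Proof.
move=> TLM posz open0; apply/setP => b.
apply/restrP/restrP => -[bM bp]; split=> // x xb; last by have := bp x xb; lia.
have := bp x xb; rewrite ltnS leq_eqVlt => /orP[/eqP eqxp|//].
rewrite -posz in eqxp; have {}eqxp := pos_inj _ _ _ eqxp; subst x.
have [y [neyz aM]] := TL_arc z TLM.
have neyzp : pos y <> p by rewrite -posz => /pos_inj/eqP; apply/negP.
have eqab := TL_eq TLM aM bM (set21 z y) xb.
have leyp : pos y < p by have := bp y; rewrite -eqab set22 => /(_ isT); lia.
have : y \in open_pts p (restr p M); last by rewrite open0 inE.
by apply/(openP _ _ _ TLM); split=> //; exists z; rewrite setUC posz.
Qed.

Lemma partial_lt_cover p M x : partial_TL p M -> x \in cover M -> pos x < p.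
Proof. by move=> partM /bigcupP[a aM]; apply: (partial_lt _ _ partM). Qed.

Lemma open_skip p M z : partial_TL p M -> pos z = p ->
  open_pts p.+1 M = z |: open_pts p M.
Proof.
move=> partM posz; apply/setP => x; rewrite !inE ltnS leq_eqVlt.
have -> : (pos x == p) = (x == z) by rewrite -posz (inj_eq (@pos_inj n)).
have [->|_] //= := eqVneq x z; apply/negP => /(partial_lt_cover _ _ _ partM).
by rewrite posz ltnn.
Qed.

Lemma partial_skip p M z : partial_TL p M -> pos z = p -> partial_TL p.+1 M.
Proof.
move=> partM posz; have openE := open_skip _ _ _ partM posz.
case: partM => tiM cardM ltM ncM openM.
split=> // [a x aM xa|a x y s aM xa ya]; first by have := ltM a x aM xa; lia.
rewrite openE => /setU1P[->|]; last exact: openM aM xa ya.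
by have := ltM a y aM ya; lia.
Qed.

Lemma cover_setU1 (T : finType) (A : {set T}) (P : {set {set T}}) :
  cover (A |: P) = A :|: cover P.
Proof. by rewrite /cover bigcup_setU big_set1. Qed.

Lemma open_close p M z s : pos z = p ->
  open_pts p.+1 ([set s; z] |: M) = open_pts p M :\ s.
Proof.
move=> posz; apply/setP => x; rewrite !inE cover_setU1 !inE !negb_or ltnS leq_eqVlt.
have -> : (pos x == p) = (x == z) by rewrite -posz (inj_eq (@pos_inj n)).
have [->|_] := eqVneq x z; last by rewrite /= andbT; case: (x == s); rewrite /= ?andbF.
by rewrite /= !andbF posz ltnn andbF.
Qed.

(** As [s] is rightmost, the remaining open points stay left of the new arc; an old arc crossing the
    new one would have had [s] under it. *)
Lemma partial_close p M z s : partial_TL p M -> pos z = p -> is_top p M s ->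
  partial_TL p.+1 ([set s; z] |: M).
Proof.
move=> partM posz tops; have openE := open_close p M z s posz.
have zNM : z \notin cover M by apply/negP => /(partial_lt_cover _ _ _ partM); lia.
case: partM tops => tiM cardM ltM ncM openM [sopen maxs].
have [ltsp sNM] : pos s < p /\ s \notin cover M by move: sopen; rewrite inE => /andP[].
split=> [|a|a x|a b|a x y t].
- apply: (proj1 (trivIsetU1 _ tiM _)) => [b bM|].
    rewrite disjoint_sym; apply/pred0P => x /=; apply/negP => /andP[xb].
    have := in_cover_arc _ _ _ bM xb.
    by move=> xM /set2P[] eqx; move: xM; rewrite eqx ?(negPf sNM) ?(negPf zNM).
  by apply/negP => /cardM; rewrite cards0.
- case/setU1P => [->|/cardM//]; rewrite cards2; case: eqP => // eqsz.
  by rewrite -posz eqsz ltnn in ltsp.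
- by case/setU1P => [-> /set2P[] ->|aM xa]; have := ltM a x; lia.
- case/setU1P => [->|aM] /setU1P[->|bM]; last exact: ncM.
  + apply/exists_inP=> -[x xa /exists_inP[y ya /exists_inP[u ub /exists_inP[t tb]]]].
    by move: xa ya ub tb => /set2P[] -> /set2P[] -> /set2P[] -> /set2P[] ->; lia.
  + apply/exists_inP=> -[x xa /exists_inP[y ya /exists_inP[u ub /exists_inP[t tb]]]].
    by move: (ltM b u bM ub) (ltM b t bM tb) xa ya => ? ? /set2P[] -> /set2P[] ->; lia.
  + apply/exists_inP=> -[x xa /exists_inP[y ya /exists_inP[u ub /exists_inP[t tb]]]].
    have := openM a x y s aM xa ya sopen.
    by move: (ltM a x aM xa) (ltM a y aM ya) ub tb => ? ? /set2P[] -> /set2P[] ->; lia.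
- rewrite openE => aM xa ya /setD1P[_ topen].
  case/setU1P: aM xa ya => [->|aM xa ya]; last exact: openM aM xa ya topen.
  move: (maxs t topen) posz ltsp; clear - n.
  by move=> lets posz ltsp /set2P[] -> /set2P[] ->; lia.
Qed.

Lemma partial_TL_full M :
  partial_TL (n + n) M -> is_TL M = (open_pts (n + n) M == set0).
Proof.
move=> partM; apply/idP/eqP => [TLM|open0].
  apply/setP => x; have /and3P[/eqP covM _ _] := TL_partition TLM.
  by rewrite !inE covM inE andbF.
case: partM => tiM cardM _ ncM _; apply/and3P; split; last first.
- by apply/forall_inP => a aM; apply/forall_inP => b; apply: ncM.
- by apply/forall_inP => a /cardM ->.
apply/and3P; split=> //; last by apply/negP => /cardM; rewrite cards0.
apply/eqP/setP => x; rewrite inE; apply: contraTT isT => xNM.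
by have : x \in open_pts (n + n) M; [rewrite inE pos_lt | rewrite open0 inE].
Qed.

(** * Enumeration of TL-diagrams by weighted walks *)

Lemma partial0 : partial_TL 0 set0.
Proof.
split=> [|a|a x|a b|a x y s]; rewrite ?inE //.
by apply/trivIsetP => a b; rewrite inE.
Qed.

Lemma restr0 M : is_TL M -> restr 0 M = set0.
Proof.
move=> TLM; apply/setP => a; rewrite in_set0; apply/restrP => -[aM ap].
have /cards2P[x [y [_ def_a]]] : #|a| == 2 by rewrite (TL_card TLM aM).
by have := ap x; rewrite def_a set21 => /(_ isT).
Qed.

(* [M0] is the part of the diagram that lies left of the gap [p]. *)
Lemma sum_TL_extensions d m p M0 : p + m = n + n -> partial_TL p M0 ->
  \sum_(M | is_TL M && (restr p M == M0))
     d.+1 ^ (\sum_(p <= q < n + n) left_gap M q.+1)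
  = blob_walks d m #|open_pts p M0|.
Proof.
elim: m p M0 => [|m IHm] p M0 /= defN partM.
  (* Everything is read: [M0] is the only candidate, and it counts iff no point is left open. *)
  rewrite addn0 in defN; subst p.
  rewrite cards_eq0 -(partial_TL_full _ partM).
  transitivity (\sum_(M | M == M0) (is_TL M : nat)); last by rewrite big_pred1_eq.
  rewrite big_mkcondl; apply: eq_big => [M|M _]; first by rewrite restr_all.
  by rewrite big_geq // expn0; case: (is_TL M).
have ltpN : p < n + n by lia.
have [z posz] := pos_surj _ _ ltpN.
(* The factor for [q = p] is split off: it is [d.+1] exactly when the step ends at height 0. *)
have stepE M1 : partial_TL p.+1 M1 ->
  \sum_(M | is_TL M && (restr p.+1 M == M1))
     d.+1 ^ (\sum_(p <= q < n + n) left_gap M q.+1)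
  = d.+1 ^ (open_pts p.+1 M1 == set0) * blob_walks d m #|open_pts p.+1 M1|.
  move=> partM1; rewrite -IHm // ?addSnnS // big_distrr /=.
  apply: eq_bigr => M /andP[TLM /eqP restrM].
  by rewrite big_ltn // expnD left_gapE // restrM.
have partS := partial_skip _ _ _ partM posz; have openS := open_skip _ _ _ partM posz.
have card_openS : #|open_pts p.+1 M0| = #|open_pts p M0|.+1.
  by rewrite openS cardsU1 inE posz ltnn.
have restrM0 M : restr p.+1 M = M0 -> restr p M = M0.
  by rewrite -(restr_restr p M) => ->; exact: partial_restr.
have skipE := stepE _ partS.
(* Opening an arc leads to a positive height, hence weight 1. *)
rewrite -cards_eq0 card_openS expn0 mul1n in skipE.
have [open0|openN0] := eqVneq (open_pts p M0) set0.
  rewrite open0 cards0 addn0 -[in RHS](cards0 (point n)) -open0 -skipE.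
  apply: eq_bigl => M; case TLM: (is_TL M) => //=.
  apply/eqP/eqP => [defM0|]; last exact: restrM0.
  by rewrite (restrS0 _ _ _ TLM posz) // defM0.
have [s tops] := exists_top _ _ openN0.
have partC := partial_close _ _ _ _ partM posz tops.
have openC := open_close p M0 z s posz.
have card_open : #|open_pts p M0| = (#|open_pts p M0 :\ s|).+1.
  by rewrite (cardsD1 s) (proj1 tops).
have closeE := stepE _ partC.
rewrite openC -cards_eq0 in closeE.
have newNM0 : [set s; z] \notin M0.
  by apply/negP => /(partial_lt _ _ partM)/(_ (set22 s z)); rewrite posz ltnn.
have restrC : restr p ([set s; z] |: M0) = M0.
  apply/setP => a; rewrite 2!inE in_set1.
  have [->|_] /= := eqVneq a [set s; z].
    rewrite (negPf newNM0); apply/forall_inP => /(_ z (set22 s z)).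
    by rewrite posz ltnn.
  by have := partial_restr _ _ partM => /setP/(_ a); rewrite inE.
(* Either [z] opens an arc, or it closes the one begun at [s]: these are the two terms of
   [blob_walks]. *)
rewrite (bigID (fun M => restr p.+1 M == M0)) /= {2}card_open.
congr (_ + _); [rewrite -skipE|rewrite -closeE]; apply: eq_bigl => M;
  case TLM: (is_TL M) => //=.
  by apply/andP/eqP => [[_ /eqP]|defM] //; rewrite defM (restrM0 _ defM).
apply/andP/eqP => [[/eqP defM0 neM]|defM].
  have topsM : is_top p (restr p M) s by rewrite defM0.
  have [] := restrS _ _ _ _ TLM posz topsM; rewrite defM0 // => eqM.
  by rewrite eqM eqxx in neM.
rewrite defM -(restr_restr p M) defM restrC; split=> //.
by apply/eqP => eqM; rewrite -eqM setU11 in newNM0.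
Qed.

Lemma sum_TL d :
  \sum_(M : {set Defs.arc n} | is_TL M) d.+1 ^ (\sum_(0 <= q < n + n) left_gap M q.+1)
  = blob_walks d (n + n) 0.
Proof.
have := sum_TL_extensions d _ _ _ (add0n (n + n)) partial0.
have -> : open_pts 0 set0 = set0 by apply/setP => x; rewrite !inE.
rewrite cards0 => <-; apply: eq_bigl => M.
by case TLM: (is_TL M); rewrite //= restr0 ?eqxx.
Qed.

(** * Counting exposed arcs *)

(** If the gap before [x] is a left gap, the partner [y] is right of [x], and an arc separating the
    gap after [y] from the left would start between [x] and [y] and cross [a]. *)
Lemma exposed_right M a : is_TL M -> a \in M -> exposed M a ->
  exists2 x, x \in a & left_gap M (pos x).+1.
Proof.
move=> TLM aM /exists_inP[x xa /orP[gapx|]]; last by exists x.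
have gap u v b q : left_gap M q -> b \in M -> u \in b -> v \in b ->
    pos u < q -> pos v < q.
  move=> /forall_inP gapq bM ub vb ltuq; rewrite ltnNge.
  apply: contra (gapq b bM) => leqv.
  by apply/exists_inP; exists u => //; apply/exists_inP; exists v; rewrite ?ltuq.
have /cards2P[u [v [neuv def_a]]] : #|a| == 2 by rewrite (TL_card TLM aM).
have [y [ya ay]] : exists y, y \in a /\ forall z, z \in a -> z = x \/ z = y.
  rewrite def_a in xa *; case/set2P: xa => ->; [exists v | exists u];
    by rewrite ?set21 ?set22; split=> // z /set2P[]; auto.
have lexy : pos x <= pos y.
  rewrite leqNgt; apply/negP => ltyx.
  by have := gap y x a _ gapx aM ya xa ltyx; rewrite ltnn.
exists y => //; apply/forall_inP => b bM; apply/exists_inP => -[s sb /exists_inP[t tb]].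
rewrite ltnS => /andP[lesy ltyt].
have ltxs : pos x <= pos s.
  rewrite leqNgt; apply/negP => ltsx; have := gap s t b _ gapx bM sb tb ltsx; lia.
have tNa : t \notin a by apply/negP => /ay[] eqt; move: ltyt; rewrite eqt; lia.
have sNa : s \notin a.
  by apply: contra tNa => sa; rewrite (TL_eq TLM aM bM sa sb).
have nexs : pos x != pos s by apply: contra sNa => /eqP/pos_inj <-.
have nesy : pos s != pos y by apply: contra sNa => /eqP/pos_inj ->.
apply: (TL_noncrossing TLM aM bM xa ya sb tb _ _ ltyt); rewrite ltn_neqAle.
  by rewrite nexs.
by rewrite nesy.
Qed.

(** Exposed arcs correspond to the points followed by a left gap, which are their right ends. *)
Lemma card_exposed M : is_TL M ->
  #|[set a in M | exposed M a]| = \sum_(0 <= q < n + n) left_gap M q.+1.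
Proof.
move=> TLM; have /and3P[/eqP covM tiM _] := TL_partition TLM.
have inM x : pblock M x \in M by rewrite pblock_mem // covM inE.
have xin x : x \in pblock M x by rewrite mem_pblock covM inE.
pose Y := [set x : point n | left_gap M (pos x).+1].
have -> : [set a in M | exposed M a] = pblock M @: Y.
  apply/setP => a; rewrite inE; apply/andP/imsetP => [[aM aexp]|[x xY ->]].
    have [x xa gapx] := exposed_right _ _ TLM aM aexp.
    by exists x; [rewrite inE | rewrite (def_pblock tiM aM xa)].
  split=> //; apply/exists_inP; exists x => //; apply/orP; right.
  by rewrite inE in xY.
rewrite card_in_imset; last first.
  (* A partner to the right of [x] would make the arc separate the gap after [x] from the left. *)
  have leY x y : x \in Y -> pblock M x = pblock M y -> pos y <= pos x.
    rewrite inE => /forall_inP/(_ _ (inM x)) + eqxy.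
    apply: contraNT; rewrite -ltnNge => ltxy.
    apply/exists_inP; exists x => //; apply/exists_inP; exists y; first by rewrite eqxy.
    by rewrite ltnSn.
  move=> x y xY yY eqxy; apply: pos_inj; apply/eqP.
  by rewrite eqn_leq !leY.
rewrite big_mkord -sum1dep_card big_mkcond /=.
have pos_bij : bijective (fun x : point n => Ordinal (pos_lt _ x)).
  apply: inj_card_bij; last by rewrite card_sum !card_ord.
  by move=> x y [/pos_inj].
rewrite [RHS](reindex _ (onW_bij _ pos_bij)) /=.
by apply: eq_bigr => x _; case: left_gap.
Qed.

(** * Components and the cardinality of the monoid *)

Lemma card_TL M : is_TL M -> #|M| = n.
Proof.
move=> TLM.
have := card_uniform_partition (fun a => TL_card TLM) (TL_partition TLM).
rewrite cardsT card_sum !card_ord addnn -muln2 => /eqP.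
by rewrite eqn_pmul2r // => /eqP.
Qed.

(** There are [n - #|B|] unblobbed arcs, and the [#|B|] blobbed ones give two singletons each. *)
Lemma card_components (D : blobbed_TL n) : #|components D| = n + #|(val D).2|.
Proof.
case: D => -[M B] /= MB; rewrite /components /=.
have /andP[/= TLM /subsetP sBE] := MB.
have sBM : B \subset M by apply/subsetP => a /sBE; rewrite inE => /andP[].
have /and3P[_ tiM _] := TL_partition TLM.
have tiB : trivIset B := trivIsetS sBM tiM.
rewrite cardsU (_ : _ :&: _ = set0) ?cards0 ?subn0; last first.
  apply/setP => c; rewrite in_set0; apply/negP => /setIP[/setDP[cM _] /imsetP[x _ def_c]].
  by have := TL_card TLM cM; rewrite def_c cards1.
rewrite cardsD (setIidPr sBM) (card_TL _ TLM) card_imset; last exact: set1_inj.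
have -> : #|cover B| = #|B| * 2.
  rewrite -(eqP tiB) -sum_nat_const; apply: eq_bigr => a aB.
  by rewrite (TL_card TLM) // (subsetP sBM).
rewrite muln2 -addnn addnA subnK //.
by have := subset_leq_card sBM; rewrite (card_TL _ TLM).
Qed.

(** The binomial theorem, grouping subsets by size. *)
Lemma sum_subsets (T : finType) (A : {set T}) d :
  \sum_(B : {set T} | B \subset A) d ^ #|B| = d.+1 ^ #|A|.
Proof.
rewrite -add1n expnDn.
rewrite (partition_big (fun B : {set T} => inord #|B| : 'I_#|A|.+1) xpredT) //=.
apply: eq_bigr => i _; rewrite exp1n mul1n -(cards_draws A i) -sum_nat_const.
apply: eq_big => [B|B /andP[sBA /eqP <-]]; last by rewrite inordK // ltnS subset_leq_card.
rewrite inE; apply: andb_id2l => sBA.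
by rewrite -val_eqE /= inordK // ltnS subset_leq_card.
Qed.

(** Labelling the components gives [d ^ (n + #|B|)]; summing over the sets [B] of exposed arcs of
    [M] turns [d ^ #|B|] into the weight used in [sum_TL]. *)
Lemma card_abacus_blob d : #|{: abacus_blob d n}| = d ^ n * blob_walks d (n + n) 0.
Proof.
rewrite card_tagged sumnE big_map big_enum /=.
under eq_bigr => D _ do rewrite card_ffun card_ord card_sig.
transitivity (\sum_(D : blobbed_TL n) d ^ n * d ^ #|(val D).2|).
  apply: eq_bigr => D _; rewrite -expnD -card_components; congr (_ ^ _).
rewrite -big_distrr /=; congr (_ * _).
rewrite -sum_TL.
pose weight (D : {set Defs.arc n} * {set Defs.arc n}) := d ^ #|D.2|.
transitivity (\sum_(D | is_blobbed_TL D) weight D).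
  by symmetry; exact: (big_sub (is_blobbed_TL (n:=n)) weight).
pose blobs M (B : {set Defs.arc n}) := B \subset [set a in M | exposed M a].
rewrite -(pair_big_dep (@is_TL n) blobs (fun M B => weight (M, B))) /=.
by apply: eq_bigr => M TLM; rewrite sum_subsets card_exposed.
Qed.

End Matchings.

Theorem theorem3p24 (d n : nat) (hd : 0 < d) (hn : 0 < n) :
  #|{: abacus_blob d n}| = d ^ n * \sum_(0 <= k < n.+1) Omega n k * d ^ k.
Proof.
by rewrite card_abacus_blob sum_Omega index_sum_blob_walks.
Qed.
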